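(* Let $P_1$ be the uniform distribution on $[0,1]$, let $P_2$ be the point mass at $1$, and let $P=\frac12P_1+\frac12P_2$. For $n\ge2$ let $\alpha_n$ be an optimal set of $n$-means for $P$ and let $V_n$ be the corresponding quantization error. Then, for every $n\ge2$, $$\alpha_n=\left\{\frac{(2i-1)\left(2n-1-\sqrt{n^2-n+1}\right)}{2(n-1)n}:1\le i\le n\right\}$$ and $$V_n=\frac{4n^2-4\left(\sqrt{n^2-n+1}+1\right)n+2\sqrt{n^2-n+1}+7}{12\left(\sqrt{n^2-n+1}+2n-1\right)^2}.$$
   Context: For a Borel probability measure $Q$ on $\mathbb R$ with finite second moment and a finite nonempty set $\alpha\subset\mathbb R$, put $V(Q;\alpha)=\int\min_{a\in\alpha}(x-a)^2\,dQ(x)$. The $n$th quantization error is $V_n=V_n(Q)=\inf\{V(Q;\alpha):\alpha\subset\mathbb R,\ 1\le\mathrm{card}(\alpha)\le n\}$. A set $\alpha$ with $1\le\mathrm{card}(\alpha)\le n$ is an optimal set of $n$-means for $Q$ if $V(Q;\alpha)=V_n(Q)$. *)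

(* Defs.v *)
From HB Require Import structures.
From mathcomp Require Import all_boot all_order all_algebra finmap.
From mathcomp Require Import all_classical all_reals all_analysis.

Set Implicit Arguments.
Unset Strict Implicit.
Unset Printing Implicit Defensive.

Import Order.TTheory GRing.Theory Num.Theory.
Import numFieldNormedType.Exports.

Local Open Scope classical_set_scope.
Local Open Scope ring_scope.

(* The minimum over A of (x - a)^2; it equals +oo only when A is empty. *)
Definition sq_dist {R : realType} (A : {fset R}) (x : R) : \bar R :=
  \big[mine/+oo%E]_(a <- A) ((x - a) ^+ 2)%:E.

Definition distortion {R : realType} (Q : probability (measurableTypeR R) R)
    (A : {fset R}) : \bar R :=
  (\int[Q]_x sq_dist A x)%E.

Definition quantization_error {R : realType}
    (Q : probability (measurableTypeR R) R) (n : nat) : \bar R :=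
  ereal_inf [set distortion Q A | A in [set A : {fset R} | 1 <= #|` A| <= n]%N].

Definition optimal_means {R : realType} (Q : probability (measurableTypeR R) R)
    (n : nat) (A : {fset R}) : Prop :=
  (1 <= #|` A| <= n)%N /\ distortion Q A = quantization_error Q n.

Definition half {R : realType} : {nonneg R} := (2^-1 : R)%:nng.

(* P = P1 / 2 + P2 / 2 with P1 uniform on [0, 1] and P2 the point mass at 1. *)
Definition mixP (R : realType) : set (measurableTypeR R) -> \bar R :=
  measure_add (mscale (@half R) (uniform_prob (@ltr01 R)))
              (mscale (@half R) (@dirac _ (measurableTypeR R) (1 : R) R)).

HB.instance Definition _ (R : realType) := Measure.on (@mixP R).

Lemma mixP_setT (R : realType) : @mixP R setT = 1%E.
Proof.
rewrite /mixP measure_addE.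
suff h (m : probability (measurableTypeR R) R) :
    mscale (@half R) m setT = (2^-1)%:E.
  rewrite [X in (X + _)%E]h [X in (_ + X)%E]h -EFinD.
  by rewrite -[X in X + _]mul1r -[X in _ + X]mul1r -splitr.
have m1 : m setT = 1%E by exact: probability_setT.
by transitivity ((2^-1)%:E * m setT)%E; rewrite // m1 mule1.
Qed.

HB.instance Definition _ (R : realType) :=
  Measure_isProbability.Build _ _ _ (@mixP R) (@mixP_setT R).

(* Main.v *)
Require Import Defs.
From mathcomp Require Import all_boot all_order all_algebra finmap.
From mathcomp Require Import all_classical all_reals all_analysis.
From mathcomp Require Import measurable_realfun zify ring lra.

Import Order.TTheory GRing.Theory Num.Theory.
Import numFieldNormedType.Exports.

Local Open Scope classical_set_scope.
Local Open Scope ring_scope.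

(* Write d for the distance to A, b for a point of A nearest to 1, and let h > 0. Pointwise
   d^2 >= h^2 - sum_{a in A} max(0, h^2 - (x - a)^2), with equality on [0, 1] when the points of
   A are spaced by at least 2h and cover [0, 1] up to distance h. Integrating over [0, 1],
     2 V(A) >= h^2 - sum_{a in A} I(a) + (1 - b)^2
   where I(a), the integral of the a-th cap, is at most 4h^3/3, with equality iff
   h <= a <= 1 - h. With t = 1 - (2n - 1)h, the quantity I(b) - (1 - b)^2 has its unique maximum
   at b = 1 - t exactly when h^2 = t^2 + 2t, which fixes h. The resulting lower bound depends
   only on n; it is attained by the points (2i - 1)h, and equality forces n points in
   [h, (2n - 1)h] spaced by at least 2h, that is, these points. *)

Section quantization.
Context {R : realType}.
Implicit Types (h a b c d x u t : R) (A B : {fset R}) (n : nat).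

(** * Parabolic caps and their primitive *)

Definition pcap h a x : R := Num.max 0 (h ^+ 2 - (x - a) ^+ 2).

Definition pcap_prim h u : R := h ^+ 2 * u - u ^+ 3 / 3.

Lemma is_derive_pcap_prim h a x :
  is_derive x (1 : R) (fun x : R => pcap_prim h (x - a)) (h ^+ 2 - (x - a) ^+ 2).
Proof.
rewrite /pcap_prim; apply: is_derive_eq.
by rewrite /GRing.scale /=; field.
Qed.

Lemma integral_parabola h a c d : c <= d ->
  (\int[@lebesgue_measure R]_(x in `[c, d]) (h ^+ 2 - (x - a) ^+ 2)%:E)%E =
  (pcap_prim h (d - a) - pcap_prim h (c - a))%:E.
Proof.
rewrite le_eqVlt => /predU1P[->|cd].
  by rewrite set_itv1 integral_set1 subrr.
have cF x : {for x, continuous (fun x : R => pcap_prim h (x - a))}.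
  apply: differentiable_continuous; apply/derivable1_diffP.
  by have [] := is_derive_pcap_prim h a x.
rewrite (continuous_FTC2 (F := fun x : R => pcap_prim h (x - a))) //.
- apply: continuous_subspaceT => x.
  apply: differentiable_continuous; apply/derivable1_diffP; exact: ex_derive.
- split=> [x _||].
  + by have [] := is_derive_pcap_prim h a x.
  + by apply: cvg_at_right_filter; apply: cF.
  + by apply: cvg_at_left_filter; apply: cF.
- move=> x _; rewrite derive1E; have is_d := is_derive_pcap_prim h a x; exact: derive_val.
Qed.

Lemma pcap_ge0 h a x : 0 <= pcap h a x.
Proof. by rewrite /pcap le_max lexx. Qed.

Lemma measurable_pcap h a (D : set R) : measurable_fun D (fun x : R => (pcap h a x)%:E).
Proof.
apply/measurable_EFinP/(@measurable_funS _ _ _ _ setT) => //.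
apply: measurable_maxr; first exact: measurable_cst.
by apply: measurable_funB => //; apply: measurable_funX; apply: measurable_funB.
Qed.

(** * The squared distance to a finite set *)

Lemma measurable_sq_dist A (D : set R) : measurable_fun D (sq_dist A).
Proof.
rewrite /sq_dist; elim: (A : seq R) => [|a s ih].
  by under eq_fun do rewrite big_nil; exact: measurable_cst.
under eq_fun do rewrite big_cons.
apply: measurable_mine ih; apply/measurable_EFinP/(@measurable_funS _ _ _ _ setT) => //.
by apply: measurable_funX; apply: measurable_funB.
Qed.

Lemma sq_dist_ge0 A x : (0 <= sq_dist A x)%E.
Proof.
rewrite /sq_dist; elim: (A : seq R) => [|a s ih]; first by rewrite big_nil leey.
by rewrite big_cons le_min ih lee_fin sqr_ge0.
Qed.

Lemma sq_dist_le A x a : a \in A -> (sq_dist A x <= ((x - a) ^+ 2)%:E)%E.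
Proof.
rewrite /sq_dist -[a \in A]/(a \in (A : seq R)).
elim: (A : seq R) => [//|b s ih]; rewrite inE big_cons ge_min => /predU1P[->|/ih ->].
  by rewrite lexx.
by rewrite orbT.
Qed.

Lemma bigmine_arg (f : R -> \bar R) (s : seq R) : (0 < size s)%N ->
  exists2 a, a \in s & (\big[mine/+oo]_(b <- s) f b = f a)%E.
Proof.
elim: s => [//|b [_ _|c s /(_ isT)[a a_s e] _]].
  by exists b; rewrite ?mem_head// big_seq1.
rewrite big_cons e; case: (leP (f b) (f a)) => _; first by exists b; rewrite ?mem_head.
by exists a; rewrite // inE a_s orbT.
Qed.

Lemma sq_dist_arg A x : (0 < #|` A|)%N ->
  exists2 a, a \in A & sq_dist A x = ((x - a) ^+ 2)%:E.
Proof. exact: bigmine_arg. Qed.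

(** * The integral of a cap over [0, 1] *)

Definition clamp h u : R := Num.max (- h) (Num.min h u).

(* Clamping truncates the parabola at its zeros [a - h] and [a + h]. *)
Definition pcap_int h a : R := pcap_prim h (clamp h (1 - a)) - pcap_prim h (clamp h (- a)).

Lemma integral_pcap h a : 0 <= h ->
  (\int[@lebesgue_measure R]_(x in `[0%R, 1%R]) (pcap h a x)%:E = (pcap_int h a)%:E)%E.
Proof.
move=> h0.
have sqE x : h ^+ 2 - (x - a) ^+ 2 = (h - (x - a)) * (h + (x - a)) by ring.
(* In the case [far] the support [a - h, a + h] misses [0, 1]: the integral vanishes, and both
   clamped values are the same end of [-h, h]. *)
have [far|near] := boolP ((h < - a) || (1 - a < - h)).
  rewrite integral0_eq => [|x /=].
    rewrite /pcap_int; have -> : clamp h (1 - a) = clamp h (- a); last by rewrite subrr.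
    by rewrite /clamp; case: (leP h (1 - a)) (leP h (- a)) => ? [] ?;
       case: leP => ? //; try (case: leP => ? //); lra.
  rewrite in_itv /= => /andP[x0 x1]; rewrite /pcap; congr EFin; apply: max_l.
  rewrite sqE; case/orP: far => ?; [apply: mulr_le0_ge0|apply: mulr_ge0_le0]; lra.
have [na n1a] : - a <= h /\ - h <= 1 - a by move: near; rewrite negb_or -!leNgt => /andP[].
(* Here [c, d] is the part of the support that lies in [0, 1], and [near] makes it nonempty. *)
pose c := Num.max 0 (a - h); pose d := Num.min 1 (a + h).
have cd : c <= d by rewrite ge_max !le_min; lra.
have -> : pcap_int h a = pcap_prim h (d - a) - pcap_prim h (c - a).
  rewrite /pcap_int; congr (pcap_prim _ _ - pcap_prim _ _); rewrite /clamp /c /d.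
    by case: (leP h (1 - a)) => ?; case: (leP 1 (a + h)) => ?; case: leP => ?; lra.
  by case: (leP h (- a)) => ?; case: (leP 0 (a - h)) => ?; case: leP => ?; lra.
rewrite -integral_parabola //.
have -> : `[c, d]%classic = `[0, 1]%classic `&` `[c, d]%classic.
  rewrite setIC; apply/esym/setIidPl => x /=; rewrite !in_itv /= ge_max le_min.
  by move=> /andP[/andP[-> _] /andP[-> _]].
rewrite integral_mkcondr; apply: eq_integral => x; rewrite inE /= in_itv /= => x01.
rewrite patchE; case: ifPn => [|]; rewrite ?notin_setE ?inE /= in_itv /= ge_max le_min.
  move=> /andP[/andP[? ?] /andP[? ?]]; rewrite /pcap max_r // sqE; apply: mulr_ge0; lra.
move=> /negP out; congr EFin; rewrite /pcap max_l // sqE.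
have [|] := boolP (a - h <= x) => ?.
  apply: mulr_le0_ge0; [|lra].
  have : ~~ (x <= a + h) by apply: contra out => ?; apply/andP; split; apply/andP; split; lra.
  lra.
apply: mulr_ge0_le0; lra.
Qed.

(** * Comparing the uniform cost with the cap integrals *)

(* The sum over [A `\ a] is the slack that makes overlapping caps strictly suboptimal. *)
Lemma sq_dist_pcap_ge h A x : (0 < #|` A|)%N ->
  exists2 a, a \in A &
    ((h ^+ 2 + \sum_(b <- (A `\ a)%fset) pcap h b x)%:E <=
     sq_dist A x + (\sum_(b <- A) pcap h b x)%:E)%E.
Proof.
move=> /(@sq_dist_arg _ x)[a aA ->]; exists a => //.
rewrite -EFinD lee_fin (big_fsetD1 a aA) /= addrA lerD2r.
by rewrite addrC -lerBlDr /pcap le_max lexx orbT.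
Qed.

Lemma sum_pcap_int h A : 0 <= h ->
  (\int[@lebesgue_measure R]_(x in `[0%R, 1%R]) (\sum_(b <- A) pcap h b x)%:E =
   (\sum_(b <- A) pcap_int h b)%:E)%E.
Proof.
move=> h0; under eq_integral do rewrite -sumEFin.
rewrite ge0_integral_sum //.
- by under eq_bigr do rewrite integral_pcap //; rewrite sumEFin.
- by move=> b; apply: measurable_pcap.
- by move=> b x _; rewrite lee_fin pcap_ge0.
Qed.

Definition unif_cost A := (\int[@lebesgue_measure R]_(x in `[0%R, 1%R]) sq_dist A x)%E.

(** Adding the caps to the cost, instead of subtracting them from h^2, keeps every integrand
    nonnegative, so the extended-real integrals add without any integrability argument. *)
Lemma unif_cost_pcapE h A : 0 <= h ->
  (unif_cost A + (\sum_(b <- A) pcap_int h b)%:E =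
   \int[@lebesgue_measure R]_(x in `[0%R, 1%R]) (sq_dist A x + (\sum_(b <- A) pcap h b x)%:E))%E.
Proof.
move=> h0; rewrite -sum_pcap_int // ge0_integralD //.
- by move=> x _; exact: sq_dist_ge0.
- exact: measurable_sq_dist.
- by move=> x _; rewrite lee_fin sumr_ge0 // => b _; exact: pcap_ge0.
- by apply/measurable_EFinP; apply: measurable_sum => b; apply/measurable_EFinP;
    exact: measurable_pcap.
Qed.

Lemma measurable_cost_pcap h A (D : set R) :
  measurable_fun D (fun x : R => (sq_dist A x + (\sum_(b <- A) pcap h b x)%:E)%E).
Proof.
apply: emeasurable_funD; first exact: measurable_sq_dist.
by apply/measurable_EFinP; apply: measurable_sum => b; apply/measurable_EFinP;
  exact: measurable_pcap.
Qed.

Lemma cost_pcap_ge0 h A x : (0 <= sq_dist A x + (\sum_(b <- A) pcap h b x)%:E)%E.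
Proof.
by rewrite adde_ge0 ?sq_dist_ge0 // lee_fin sumr_ge0 // => b _; exact: pcap_ge0.
Qed.

Lemma integral_cst01 c : (\int[@lebesgue_measure R]_(x in `[0%R, 1%R]) c%:E = c%:E)%E.
Proof. by rewrite integral_cst //= lebesgue_measure_itv /= lte_fin ltr01 sube0 mule1. Qed.

Lemma unif_cost_ge h A : 0 <= h -> (0 < #|` A|)%N ->
  ((h ^+ 2)%:E <= unif_cost A + (\sum_(b <- A) pcap_int h b)%:E)%E.
Proof.
move=> h0 A0; rewrite unif_cost_pcapE // -[leLHS]integral_cst01.
apply: ge0_le_integral => //.
- by move=> x _; rewrite lee_fin sqr_ge0.
- exact: measurable_cost_pcap.
- move=> x _; have [a _] := sq_dist_pcap_ge h A x A0; apply: le_trans.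
  by rewrite lee_fin lerDl sumr_ge0 // => b _; exact: pcap_ge0.
Qed.

Lemma unif_cost_le h A : 0 <= h ->
  (forall x, 0 <= x <= 1 ->
     (sq_dist A x + (\sum_(b <- A) pcap h b x)%:E <= (h ^+ 2)%:E)%E) ->
  (unif_cost A + (\sum_(b <- A) pcap_int h b)%:E <= (h ^+ 2)%:E)%E.
Proof.
move=> h0 le_h; rewrite unif_cost_pcapE // -[leRHS]integral_cst01.
apply: ge0_le_integral => //.
- by move=> x _; exact: cost_pcap_ge0.
- exact: measurable_cost_pcap.
Qed.

(** Points closer than 2h have overlapping caps. Just left of their midpoint both caps are bounded
    below by some e > 0, and at least one of them stays in the slack of [sq_dist_pcap_ge]. The
    bounds [h <= a] and [b <= 1] keep this region inside [0, 1]. *)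
Lemma unif_cost_gt h A a b : a \in A -> b \in A -> h <= a -> a < b -> b <= 1 ->
  b - a < 2 * h ->
  ((h ^+ 2)%:E < unif_cost A + (\sum_(b <- A) pcap_int h b)%:E)%E.
Proof.
move=> aA bA ha ab b1 close.
have h0 : 0 <= h by lra.
have A0 : (0 < #|` A|)%N by rewrite cardfs_gt0; apply/fset0Pn; exists a.
(* With r half the gap and m the midpoint, every x in [m - d, m] is within r + d of both a and b.
   Since d is half of h - r, this radius is still below h, hence e > 0. *)
pose r := (b - a) / 2; pose m := (a + b) / 2; pose d := (h - r) / 2.
pose e := h ^+ 2 - (r + d) ^+ 2.
have d0 : 0 < d by rewrite /d /r; lra.
have e0 : 0 < e.
  rewrite /e (_ : _ - _ = (h - r - d) * (h + r + d)); last by ring.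
  by apply: mulr_gt0; rewrite /d /r; lra.
have pcap_e x c : (c = a) \/ (c = b) -> x \in `[m - d, m] -> e <= pcap h c x.
  rewrite in_itv /= => cab /andP[x1 x2]; rewrite /pcap le_max; apply/orP; right.
  rewrite lerD2l lerN2 -ler_sqrt; last by rewrite sqr_ge0.
  rewrite !sqrtr_sqr; rewrite [leRHS]ger0_norm; last by rewrite /d /r; lra.
  by rewrite ler_norml; move: x1 x2; rewrite /d /r /m; case: cab => ->; lra.
rewrite unif_cost_pcapE //.
apply: (@lt_le_trans _ _ ((h ^+ 2)%:E + (e * d)%:E)%E).
  by rewrite -EFinD lte_fin ltrDl mulr_gt0.
have -> : ((h ^+ 2)%:E + (e * d)%:E =
    \int[@lebesgue_measure R]_(x in `[0%R, 1%R])
      ((h ^+ 2)%:E + (e%:E * (\1_(`[m - d, m]) x)%:E)))%E.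
  rewrite ge0_integralD //; last 3 first.
  - by move=> x _; rewrite lee_fin sqr_ge0.
  - by move=> x _; rewrite -EFinM lee_fin mulr_ge0 // ltW.
  - by apply/measurable_EFinP; apply: measurable_funM.
  rewrite integral_cst01 ge0_integralZl_EFin //; last 2 first.
  - by apply/measurable_EFinP.
  - exact: ltW.
  rewrite integral_indic // setIidl; last first.
    by move=> x /=; rewrite !in_itv /= /d /m /r => /andP[? ?]; apply/andP; split; lra.
  rewrite [X in (_ * X)%E]lebesgue_measure_itv /= lte_fin.
  rewrite ifT; last by lra.
  by rewrite -EFinB -EFinM -!EFinD; congr EFin; ring.
apply: ge0_le_integral => //.
- by move=> x _; rewrite -EFinM -EFinD lee_fin addr_ge0 ?sqr_ge0 // mulr_ge0 // ltW.
- by apply: emeasurable_funD => //; apply/measurable_EFinP; exact: measurable_funM.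
- exact: measurable_cost_pcap.
- move=> x _; have [c cA] := sq_dist_pcap_ge h A x A0; apply: le_trans.
  rewrite -EFinM -EFinD lee_fin lerD2l indicE.
  have sum0 (B : {fset R}) : 0 <= \sum_(b0 <- B) pcap h b0 x.
    by rewrite sumr_ge0 // => ? _; exact: pcap_ge0.
  have [/set_mem xI|_] := boolP (x \in _); last by rewrite mulr0.
  (* The point c missing from the slack sum equals at most one of a and b; the other one is c'. *)
  have [c' c'A c'ab] : exists2 c', c' \in (A `\ c)%fset & c' = a \/ c' = b.
    have [ca|ca] := eqVneq c a; [exists b|exists a]; rewrite ?in_fsetD1 ?aA ?bA //; auto.
      by rewrite ca gt_eqF.
    by rewrite eq_sym ca.
  rewrite (big_fsetD1 c') //= mulr1; apply: (le_trans (pcap_e x c' c'ab xI)).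
  by rewrite lerDl.
Qed.

(** * Reduction to the uniform part and the atom *)

Lemma distortion_mixP A : distortion (@mixP R) A = (2^-1%:E * (unif_cost A + sq_dist A 1))%E.
Proof.
have mA : measurable_fun setT (sq_dist A) := measurable_sq_dist A setT.
have A0 x : [set: R] x -> (0 <= sq_dist A x)%E by move=> _; exact: sq_dist_ge0.
rewrite /distortion /mixP ge0_integral_measure_add //.
rewrite !ge0_integral_mscale // integral_uniform //; last by move=> x; exact: A0.
rewrite integral_dirac // diracT mul1e subr0 invr1 mul1e [RHS]muleDr //.
apply: ge0_adde_def; rewrite inE; last exact: sq_dist_ge0.
by apply: integral_ge0 => x _; exact: sq_dist_ge0.
Qed.

(** * Sharp upper bounds for the cap integrals *)

Lemma clamp_itv h u : 0 <= h -> - h <= clamp h u <= h.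
Proof.
move=> h0; rewrite /clamp; case: (leP h u) => ?; [case: (leP (- h) h)|case: (leP (- h) u)] => ?;
  by apply/andP; split; lra.
Qed.

Lemma clampN h u : 0 <= h -> clamp h (- u) = - clamp h u.
Proof.
move=> h0; rewrite /clamp; case: (leP h u) => ?; case: (leP h (- u)) => ?.
- by case: (leP (- h) h) => ?; lra.
- by case: (leP (- h) (- u)) => ?; case: (leP (- h) h) => ?; lra.
- by case: (leP (- h) h) => ?; case: (leP (- h) u) => ?; lra.
- by case: (leP (- h) (- u)) => ?; case: (leP (- h) u) => ?; lra.
Qed.

Lemma clamp_eq h u : 0 < h -> (clamp h u == h) = (h <= u).
Proof.
move=> h0; rewrite /clamp; case: (leP h u) => ?.
  by case: (leP (- h) h) => ?; apply/eqP; lra.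
by case: (leP (- h) u) => ?; apply/eqP; lra.
Qed.

(** The deficit is (h - u)^2 (2h + u) / 3. On [-h, h] the last factor is at least h, so it vanishes
    only if h = 0, and then u = h as well. *)
Lemma pcap_prim_max h u : - h <= u <= h -> pcap_prim h u <= 2 * h ^+ 3 / 3 ?= iff (u == h).
Proof.
move=> /andP[hu uh].
have E : 2 * h ^+ 3 / 3 - pcap_prim h u = (h - u) ^+ 2 * (2 * h + u) / 3.
  by rewrite /pcap_prim; field.
split.
  by rewrite -subr_ge0 E divr_ge0 // mulr_ge0 ?sqr_ge0 //; lra.
apply/eqP/eqP => [e|->]; last by rewrite /pcap_prim; field.
move: E; rewrite e subrr => /esym/eqP; rewrite mulf_eq0 invr_eq0 (_ : 3 == 0 = false) ?orbF; last first.
  by apply/negbTE; rewrite lt0r_neq0.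
rewrite mulf_eq0 sqrf_eq0 => /orP[|] /eqP ?; lra.
Qed.

Lemma pcap_primN h u : pcap_prim h (- u) = - pcap_prim h u.
Proof. by rewrite /pcap_prim; field. Qed.

(** Since the primitive is odd, the cap splits at its centre into a term governed by the end 1 and a
    term governed by the end 0, to be maximised separately. *)
Lemma pcap_intE h a : 0 <= h ->
  pcap_int h a = pcap_prim h (clamp h (1 - a)) + pcap_prim h (clamp h a).
Proof. by move=> h0; rewrite /pcap_int clampN // pcap_primN opprK. Qed.

Lemma pcap_int_max h a : 0 < h -> pcap_int h a <= 4 * h ^+ 3 / 3 ?= iff (h <= a <= 1 - h).
Proof.
move=> h0; have h0' := ltW h0.
have E : 4 * h ^+ 3 / 3 = 2 * h ^+ 3 / 3 + 2 * h ^+ 3 / 3 by field.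
have -> : (h <= a <= 1 - h) = (clamp h (1 - a) == h) && (clamp h a == h).
  by rewrite !clamp_eq // andbC lerBrDr addrC -lerBrDr.
rewrite pcap_intE // E; apply: leifD; apply: pcap_prim_max; exact: clamp_itv.
Qed.

(** Used with u = 1 - b. The derivative of [pcap_prim h u - u ^+ 2] is h^2 - u^2 - 2u, so the
    relation between h and t says that t is critical; [h <= 1] keeps the cofactor in [E] positive
    for v >= -h. *)
Lemma end_max h t u : 0 < t < h -> h ^+ 2 = t ^+ 2 + 2 * t -> h <= 1 ->
  pcap_prim h (clamp h u) - u ^+ 2 <= pcap_prim h t - t ^+ 2 ?= iff (u == t).
Proof.
move=> /andP[t0 th] ht h1; have h0 : 0 < h by lra.
(* [t] is a critical point of the cubic, so [(t - v) ^+ 2] factors out. *)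
have E v : (pcap_prim h t - t ^+ 2) - (pcap_prim h v - v ^+ 2) =
    (t - v) ^+ 2 * (1 + 2 * t / 3 + v / 3) by rewrite /pcap_prim ht; field.
have E1 v : - h <= v -> v != t -> pcap_prim h v - v ^+ 2 < pcap_prim h t - t ^+ 2.
  move=> hv vt; rewrite -subr_gt0 E mulr_gt0 //; last by lra.
  by rewrite lt0r sqr_ge0 sqrf_eq0 subr_eq0 eq_sym vt.
have strict : u != t -> pcap_prim h (clamp h u) - u ^+ 2 < pcap_prim h t - t ^+ 2.
  (* Beyond [-h, h] the clamped term is constant while u^2 exceeds h^2 or equals it, so comparison
     with the end h or -h suffices. *)
  move=> ut; rewrite /clamp; case: (leP h u) => hu.
    rewrite (max_r _); last by lra.
    apply: le_lt_trans (E1 h _ _); [nra|lra|].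
    by apply/eqP; lra.
  have [Nhu|uNh] := leP (- h) u; first by apply: E1.
  apply: le_lt_trans (E1 (- h) _ _); [nra|by []|].
  by apply/eqP; lra.
have [->|ut] := eqVneq u t; last first.
  by split; [exact: ltW (strict ut)|exact: lt_eqF (strict ut)].
have -> : clamp h t = t; last exact: leif_refl.
rewrite /clamp; case: (leP h t) => ?; first by lra.
by apply: max_r; lra.
Qed.

(** The atom's penalty is charged to the right half of the cap at b, where [end_max] applies. The
    left half is full at b = 1 - t because h + t <= 1, so both maxima are reached together. *)
Lemma pcap_int_end_max h t b : 0 < t < h -> h ^+ 2 = t ^+ 2 + 2 * t -> h + t <= 1 ->
  pcap_int h b - (1 - b) ^+ 2 <= 2 * h ^+ 3 / 3 + (pcap_prim h t - t ^+ 2) ?= iff (b == 1 - t).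
Proof.
move=> t0h ht h1; have h0 : 0 < h by lra.
have -> : (b == 1 - t) = (clamp h b == h) && (1 - b == t).
  rewrite clamp_eq //; apply/idP/idP; first by move=> /eqP ->; apply/andP; split; [|apply/eqP]; lra.
  by move=> /andP[_ /eqP <-]; apply/eqP; ring.
rewrite pcap_intE ?ltW // -addrA [X in X <= _ ?= iff _]addrA.
rewrite (addrC (pcap_prim h (clamp h (1 - b)))) -addrA.
apply: leifD; first by apply: pcap_prim_max; apply: clamp_itv; exact: ltW.
by apply: end_max => //; lra.
Qed.

(** * The lower bound for the cost and its equality case *)

Lemma sum_pcap_int_le h B : 0 < h ->
  \sum_(a <- B) pcap_int h a <= #|` B|%:R * (4 * h ^+ 3 / 3).
Proof.
move=> h0; rewrite mulr_natl -[X in _ *+ X](count_predT (enum_fset B)) -iter_addr_0 -big_const_seq.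
by apply: ler_sum => a _; rewrite (pcap_int_max _ a h0).
Qed.

(* Twice the quantization error: the uniform part and the atom are not weighted by 1/2. *)
Definition opt_val n h t : R :=
  h ^+ 2 - (n%:R - 1) * (4 * h ^+ 3 / 3) - (2 * h ^+ 3 / 3 + (pcap_prim h t - t ^+ 2)).

(** The real r stands for the uniform cost once it is known to be finite. Having fewer than n points
    only helps the bound, as each absent cap would be allowed 4h^3/3 > 0. *)
Lemma opt_val_le n h t A b r : 0 < t < h -> h ^+ 2 = t ^+ 2 + 2 * t -> h + t <= 1 ->
  (#|` A| <= n)%N -> b \in A -> h ^+ 2 <= r + \sum_(a <- A) pcap_int h a ->
  opt_val n h t <= r + (1 - b) ^+ 2.
Proof.
move=> t0h ht h1 An bA hr; have h0 : 0 < h by lra.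
have c0 : 0 < h ^+ 3 by rewrite exprn_gt0.
have [Ib _] := pcap_int_end_max h t b t0h ht h1.
move: hr; rewrite (big_fsetD1 b) //= => hr.
have := sum_pcap_int_le h (A `\ b)%fset h0.
move: An; rewrite (cardfsD1 b) bA add1n -(ler_nat R) -natr1 => An.
rewrite /opt_val; nra.
Qed.

(** Equality forces every inequality behind [opt_val_le] to be tight: the count of points, the end
    cap, each other cap, and the integrated pointwise bound. *)
Lemma opt_val_eq n h t A b r : 0 < t < h -> h ^+ 2 = t ^+ 2 + 2 * t -> h + t <= 1 ->
  (#|` A| <= n)%N -> b \in A -> h ^+ 2 <= r + \sum_(a <- A) pcap_int h a ->
  r + (1 - b) ^+ 2 = opt_val n h t ->
  [/\ #|` A| = n, b = 1 - t, forall a, a \in A -> a != b -> h <= a <= 1 - h &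
      h ^+ 2 = r + \sum_(a <- A) pcap_int h a].
Proof.
move=> t0h ht h1 An bA hr; have h0 : 0 < h by lra.
have c0 : 0 < h ^+ 3 by rewrite exprn_gt0.
have [Ib Ibe] := pcap_int_end_max h t b t0h ht h1.
move: hr; rewrite (big_fsetD1 b) //= => hr.
have S := sum_pcap_int_le h (A `\ b)%fset h0.
move: (An); rewrite -(ler_nat R) (cardfsD1 b) bA add1n -natr1 => An' e.
move: e; rewrite /opt_val => e.
(* Up to the factor 4/3, this is the loss caused by using fewer than n points. *)
have m0 : 0 <= (n%:R - (#|` (A `\ b)%fset|%:R + 1)) * h ^+ 3 :> R.
  by rewrite mulr_ge0 //; [lra|exact: ltW].
split.
- apply/eqP; rewrite -(eqr_nat R) -natr1.
  have /eqP : (n%:R - (#|` (A `\ b)%fset|%:R + 1)) * h ^+ 3 = 0 :> R by nra.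
  by rewrite mulf_eq0 (gt_eqF c0) orbF subr_eq0 eq_sym.
- apply/eqP; rewrite -Ibe; apply/eqP; nra.
- move=> a aA ab; rewrite -(pcap_int_max _ a h0).
  have aB : a \in (A `\ b)%fset by rewrite in_fsetD1 ab.
  (* Taking a out of the sum as well isolates its own deficit; the remaining points are bounded as
     before. *)
  move: S hr; rewrite (big_fsetD1 a) //= => S hr.
  have S' := sum_pcap_int_le h ((A `\ b) `\ a)%fset h0.
  have := (pcap_int_max _ a h0).1.
  move: m0; rewrite (cardfsD1 a) aB add1n -natr1 => m0 ?.
  by apply/eqP; nra.
- nra.
Qed.

(** * The equally spaced grid *)

Definition grid n h : {fset R} := [fset ((2 * i%:R - 1) * h : R) | i in iota 1 n]%fset.

Lemma gridP n h a :
  reflect (exists2 i, (i < n)%N & a = (2 * i%:R + 1) * h) (a \in grid n h).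
Proof.
apply: (iffP (imfsetP _ _ _ _)) => /= [[i]|[i lt_in ->]].
  rewrite mem_iota add1n ltnS => /andP[i0 le_in] ->; exists i.-1; first by rewrite prednK.
  by rewrite -[in LHS](prednK i0) -natr1; ring.
by exists i.+1; rewrite ?mem_iota //= -natr1; ring.
Qed.

Lemma card_grid n h : 0 < h -> #|` grid n h| = n.
Proof.
move=> h0; rewrite card_imfset.
  rewrite -[RHS](size_iota 1); apply: perm_size.
  by apply: uniq_perm; [exact: enum_finmem_uniq|exact: iota_uniq|move=> i; rewrite enum_finmemE].
move=> i j /(mulIf (lt0r_neq0 h0)) e; apply/eqP; rewrite -(eqr_nat R); apply/eqP; lra.
Qed.

(** The interval has length (2n - 2)h, exactly n - 1 minimal gaps. In the sorted list, counting gaps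
    from the left end bounds each entry below, counting from the right end bounds it above, and the
    two bounds coincide. *)
Lemma spaced_grid n h A : 0 < h -> #|` A| = n ->
  (forall a, a \in A -> h <= a <= (2 * n%:R - 1) * h) ->
  (forall a b, a \in A -> b \in A -> a < b -> 2 * h <= b - a) ->
  A = grid n h.
Proof.
move=> h0 An bnd gap.
pose s := sort <=%R (enum_fset A).
have sz : size s = n by rewrite size_sort.
have sA i : (i < n)%N -> nth 0 s i \in A.
  by rewrite -sz => /(mem_nth 0); rewrite mem_sort.
have slt : sorted <%R s.
  by rewrite sort_lt_sorted fset_uniq.
have step i : (i.+1 < n)%N -> nth 0 s i + 2 * h <= nth 0 s i.+1.
  move=> lt_in; have lt_in' : (i < n)%N by exact: ltnW.
  rewrite addrC -lerBrDr; apply: gap; rewrite ?sA //.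
  by apply: (sorted_ltn_nth lt_trans) => //; rewrite inE sz.
have lower i : (i < n)%N -> (2 * i%:R + 1) * h <= nth 0 s i.
  elim: i => [|i ih] lt_in.
    by have /andP[] := bnd _ (sA 0%N lt_in); lra.
  by move: (ih (ltnW lt_in)) (step i lt_in); rewrite -natr1; lra.
(* Here j counts positions from the right, the last entry being j = 0. *)
have upper j : (j < n)%N -> nth 0 s (n.-1 - j) <= (2 * (n%:R - j%:R) - 1) * h.
  elim: j => [|j ih] lt_jn.
    have lt_n : (n.-1 - 0 < n)%N by lia.
    by have /andP[] := bnd _ (sA _ lt_n); lra.
  have lt_n : ((n.-1 - j.+1).+1 < n)%N by lia.
  have := step _ lt_n; rewrite (_ : (n.-1 - j.+1).+1 = n.-1 - j)%N; last by lia.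
  by move: (ih (ltnW lt_jn)); rewrite -natr1; lra.
(* Both sets have n elements, so one inclusion is enough. *)
apply/eqP; rewrite eqEfcard card_grid // An leqnn andbT.
apply/fsubsetP => a; rewrite -[a \in A]/(a \in enum_fset A) -(mem_sort <=%R) => /(nthP 0)[i].
rewrite -/s sz => lt_in <-; apply/gridP; exists i => //.
apply/eqP; rewrite eq_le lower // andbT.
have lt_n : (n.-1 - i < n)%N by lia.
move: (upper _ lt_n); rewrite (_ : n.-1 - (n.-1 - i) = i)%N; last by lia.
rewrite -natrB; last by lia.
by rewrite (_ : n - (n.-1 - i) = i.+1)%N -?natr1; [lra|lia].
Qed.

(** The intervals of radius h around the grid points tile [0, 2nh]; the induction peels off the last
    tile. *)
Lemma grid_near n h x : (0 < n)%N -> 0 <= x <= 2 * n%:R * h ->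
  exists2 a, a \in grid n h & `|x - a| <= h.
Proof.
move=> n0 xn; suff [i lt_in ?] : exists2 i, (i < n)%N & `|x - (2 * i%:R + 1) * h| <= h.
  by exists ((2 * i%:R + 1) * h) => //; apply/gridP; exists i.
elim: n n0 xn => [//|[|n] ih] _ xn; first by exists 0%N => //; rewrite ler_norml; lra.
have [le|gt] := lerP x (2 * n.+1%:R * h).
  have [|i lt_in ?] := ih isT; first by rewrite le; case/andP: xn => ->.
  by exists i => //; exact: ltnW.
exists n.+1 => //; move: xn; rewrite -(natr1 n.+1) => /andP[_ ?]; rewrite ler_norml; lra.
Qed.

Lemma grid_gap n h a b : 0 < h -> a \in grid n h -> b \in grid n h -> a != b ->
  2 * h <= `|a - b|.
Proof.
move=> h0 /gridP[i _ ->] /gridP[j _ ->] ij.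
have {ij} : (i != j) by apply: contra ij => /eqP ->.
rewrite (_ : _ - _ = 2 * (i%:R - j%:R) * h); last by ring.
rewrite ler_normr neq_ltn => /orP[]; rewrite -(ler_nat R) -natr1 => ?; apply/orP; [right|left]; nra.
Qed.

(** * The optimal cost and the optimal sets *)

Lemma unif_cost_ge0 A : (0 <= unif_cost A)%E.
Proof. by apply: integral_ge0 => x _; exact: sq_dist_ge0. Qed.

Lemma opt_val_le_cost n h t A :
  0 < t < h -> h ^+ 2 = t ^+ 2 + 2 * t -> h + t <= 1 -> (1 <= #|` A| <= n)%N ->
  ((opt_val n h t)%:E <= unif_cost A + sq_dist A 1)%E.
Proof.
move=> t0h ht h1 /andP[A0 An]; have h0 : 0 <= h by lra.
have [b bA ->] := sq_dist_arg A 1 A0.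
move: (unif_cost_ge h A h0 A0) (unif_cost_ge0 A).
case: (unif_cost A) => [r||//] hr _; last by rewrite addye ?leey.
by move: hr; rewrite -!EFinD !lee_fin; exact: opt_val_le.
Qed.

Lemma cost_eq_opt_val n h t A :
  0 < t < h -> h ^+ 2 = t ^+ 2 + 2 * t -> (2 * n%:R - 1) * h + t = 1 -> h + t <= 1 ->
  (1 <= #|` A| <= n)%N ->
  (unif_cost A + sq_dist A 1 = (opt_val n h t)%:E)%E -> A = grid n h.
Proof.
move=> t0h ht nh h1 /andP[A0 An]; have h0 : 0 < h by lra.
have [b bA ->] := sq_dist_arg A 1 A0.
move: (unif_cost_ge h A (ltW h0) A0) (fun a b => unif_cost_gt h A a b) (unif_cost_ge0 A).
case: (unif_cost A) => [r||//] hr overlap _ // [e].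
move: hr; rewrite -EFinD lee_fin => hr.
have [cA b_eq bnd sharp] := opt_val_eq n h t A b r t0h ht h1 An bA hr e.
have inA a : a \in A -> h <= a <= 1 - t.
  by have [-> _|ab aA] := eqVneq a b; [rewrite b_eq|have := bnd a aA ab]; lra.
apply: spaced_grid => // [a /inA|a c aA cA' ac]; first by lra.
(* Two points closer than 2h would make the integrated bound strict, against [sharp]. *)
rewrite leNgt; apply/negP => close.
have := overlap a c aA cA'; rewrite -EFinD lte_fin -sharp ltxx.
have := inA _ aA; have := inA _ cA' => /andP[? ?] /andP[? ?].
by move=> H; suff: false by []; apply: H; lra.
Qed.

Lemma grid_cost n h t :
  0 < t < h -> h ^+ 2 = t ^+ 2 + 2 * t -> (2 * n%:R - 1) * h + t = 1 -> h + t <= 1 ->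
  (0 < n)%N -> (unif_cost (grid n h) + sq_dist (grid n h) 1 = (opt_val n h t)%:E)%E.
Proof.
move=> t0h ht nh h1 n0; have h0 : 0 < h by lra.
have cG := card_grid n h h0.
apply/eqP; rewrite eq_le opt_val_le_cost ?cG ?n0 ?leqnn // andbT.
have pw x : 0 <= x <= 1 ->
    (sq_dist (grid n h) x + (\sum_(b <- grid n h) pcap h b x)%:E <= (h ^+ 2)%:E)%E.
  (* The grid reaches all of [0, 1] because 2nh = 1 + h - t > 1. Within h of a, every other grid
     point is at distance at least h, so its cap vanishes at x. *)
  move=> /andP[x0 x1]; have [|a aG xa] := grid_near n h x n0; first by rewrite x0 /=; nra.
  apply: (@le_trans _ _ (((x - a) ^+ 2)%:E + (h ^+ 2 - (x - a) ^+ 2)%:E)%E); last first.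
    by rewrite -EFinD lee_fin addrC subrK.
  apply: leeD; first exact: sq_dist_le.
  rewrite lee_fin (big_fsetD1 a) //= big1_fset ?addr0 => [|c].
    rewrite /pcap max_r // subr_ge0 -(real_normK (num_real (x - a))).
    by rewrite ler_sqr ?nnegrE // ltW.
  rewrite in_fsetD1 => /andP[ca cGr] _.
  have := grid_gap n h c a h0 cGr aG ca.
  have := ler_distD x c a; rewrite (distrC c x) => tri far; have xc : h <= `|x - c| by lra.
  rewrite /pcap max_l // subr_le0 -(real_normK (num_real (x - c))).
  by rewrite ler_sqr ?nnegrE // ltW.
have := unif_cost_le h (grid n h) (ltW h0) pw.
(* The last grid point, with zero-based index n - 1, is (2n - 1)h = 1 - t. *)
have bG : 1 - t \in grid n h.
  apply/gridP; exists n.-1; first by rewrite prednK.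
  by have := @natr1 R n.-1; rewrite prednK // => ?; nra.
have := sq_dist_le (grid n h) 1 (1 - t) bG.
have -> : \sum_(b <- grid n h) pcap_int h b =
    2 * h ^+ 3 / 3 + (pcap_prim h t - t ^+ 2) + t ^+ 2 + (n%:R - 1) * (4 * h ^+ 3 / 3).
  rewrite (big_fsetD1 (1 - t)) //=; congr (_ + _).
    have [_] := pcap_int_end_max h t (1 - t) t0h ht h1.
    by rewrite (eqxx (1 - t)) => /eqP <-; ring.
  transitivity (\sum_(a <- (grid n h `\ (1 - t))%fset) (4 * h ^+ 3 / 3)).
    rewrite [LHS]big_seq [RHS]big_seq; apply: eq_bigr => a.
    rewrite in_fsetD1 => /andP[at1 /gridP[i lt_in ae]].
    apply/eqP; rewrite (pcap_int_max h a h0); rewrite ae.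
    (* A grid point other than the last is at most 1 - t - 2h, so its cap fits inside [0, 1]. *)
    have {}at1 : (i.+1 < n)%N.
      rewrite ltn_neqAle lt_in andbT; apply: contra at1 => /eqP i_n.
      by move: nh; rewrite ae -i_n -natr1 => ?; apply/eqP; lra.
    have i0 : 0 <= i%:R :> R by [].
    by move: at1; rewrite -(ler_nat R) -!natr1 => ?; apply/andP; split; nra.
  rewrite big_const_seq count_predT iter_addr_0 -[LHS]mulr_natl; congr (_ * _).
  suff <- : #|` (grid n h `\ (1 - t))%fset|%:R + 1 = n%:R :> R by rewrite addrK.
  by rewrite natr1 -[in RHS]cG [in RHS](cardfsD1 (1 - t)) bG.
move: (unif_cost_ge0 (grid n h)) (sq_dist_ge0 (grid n h) 1).
case: (unif_cost _) => [r||//] //; case: (sq_dist _ 1) => [s||//] // _ _.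
rewrite -!EFinD !lee_fin (_ : (1 - (1 - t)) = t) ?/opt_val; [|ring]; lra.
Qed.

(** The optimum is described by any h and t that solve the criticality relation and the tiling
    equation; no closed form enters yet. *)
Lemma quantization_mixP n h t :
  0 < t < h -> h ^+ 2 = t ^+ 2 + 2 * t -> (2 * n%:R - 1) * h + t = 1 -> h + t <= 1 ->
  (0 < n)%N ->
  (forall A, optimal_means (@mixP R) n A <-> A = grid n h) /\
  quantization_error (@mixP R) n = (opt_val n h t / 2)%:E.
Proof.
move=> t0h ht nh h1 n0; have h0 : 0 < h by lra.
have gridE : distortion (@mixP R) (grid n h) = (opt_val n h t / 2)%:E.
  by rewrite distortion_mixP (grid_cost n h t) // -EFinM mulrC.
have card_ok : (1 <= #|` grid n h| <= n)%N by rewrite card_grid // n0 leqnn.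
have qE : quantization_error (@mixP R) n = (opt_val n h t / 2)%:E.
  apply/eqP; rewrite eq_le; apply/andP; split.
    by rewrite -gridE; apply: ereal_inf_lbound; exists (grid n h).
  apply: le_ereal_inf_tmp => _ [A /= An <-].
  rewrite distortion_mixP mulrC EFinM; apply: lee_wpmul2l; first by rewrite lee_fin.
  exact: opt_val_le_cost.
split=> // A; split=> [[An]|->]; last by split; rewrite // gridE qE.
rewrite qE distortion_mixP => e; apply: (cost_eq_opt_val n h t) => //; move: e.
case: (_ + _)%E => [r [e]||]; first by congr EFin; lra.
  by rewrite gt0_muley // lte_fin.
by rewrite gt0_muleNy // lte_fin.
Qed.

End quantization.

(** * Closed forms for h and t *)

Theorem proposition3p2 (R : realType) (n : nat) (hn : (2 <= n)%N) :
  (forall A : {fset R},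
     optimal_means (@mixP R) n A <->
     A = [fset ((2 * i%:R - 1)
               * (2 * n%:R - 1 - Num.sqrt (n%:R ^+ 2 - n%:R + 1))
               / (2 * (n%:R - 1) * n%:R) : R) | i in iota 1 n]%fset) /\
  quantization_error (@mixP R) n =
    ((4 * n%:R ^+ 2 - 4 * (Num.sqrt (n%:R ^+ 2 - n%:R + 1) + 1) * n%:R
        + 2 * Num.sqrt (n%:R ^+ 2 - n%:R + 1) + 7)
     / (12 * (Num.sqrt (n%:R ^+ 2 - n%:R + 1) + 2 * n%:R - 1) ^+ 2))%:E.
Proof.
set N : R := n%:R; set s := Num.sqrt _.
have N2 : 2 <= N by rewrite ler_nat.
have s2 : s ^+ 2 = N ^+ 2 - N + 1 by rewrite sqr_sqrtr // /N; nra.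
have s0 : 0 <= s by exact: sqrtr_ge0.
have sN : 2 * N - 1 < 2 * s by nra.
pose D := 2 * N - 1 + s; have D0 : 0 < D by rewrite /D; lra.
(* Substituting t = 1 - (2N - 1)h into h^2 = t^2 + 2t gives 4N(N - 1)h^2 - 4(2N - 1)h + 3 = 0. This
   h is the smaller root, the one with t > 0, rationalised by (2N - 1 - s)(2N - 1 + s) = 3N(N - 1);
   [hE] recovers the form in the statement. *)
pose h := 3 / (2 * D); pose t := (2 * s - (2 * N - 1)) / (2 * D).
have hE : (2 * N - 1 - s) / (2 * (N - 1) * N) = h.
  by rewrite /h /D; field: s2; rewrite -/N -/D; apply/and3P; split; apply/eqP; lra.
have t0 : 0 < t by rewrite divr_gt0 //; lra.
have th : t < h by rewrite ltr_pM2r ?invr_gt0 //; nra.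
have ht : h ^+ 2 = t ^+ 2 + 2 * t.
  by rewrite /h /t /D; field: s2; rewrite -/N -/D; apply/eqP; lra.
have nh : (2 * N - 1) * h + t = 1.
  by rewrite /h /t /D; field; rewrite -/N -/D; apply/eqP; lra.
have h1 : h + t <= 1 by nra.
have [||optE ->] := @quantization_mixP R n h t _ ht nh h1; [by rewrite t0|exact: ltnW|].
split=> [A|].
  rewrite optE; suff -> : grid n h =
      [fset ((2 * i%:R - 1) * (2 * N - 1 - s) / (2 * (N - 1) * N) : R) | i in iota 1 n]%fset by [].
  by apply: eq_imfset => // i; rewrite -mulrA hE.
congr EFin; rewrite /opt_val /pcap_prim /h /t /D -/N (_ : s + 2 * N - 1 = D); last by rewrite /D; ring.
by rewrite /D; field: s2; rewrite -/N -/D; apply/eqP; lra.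
Qed.
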